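(* Let $\mathcal S\colon\mathtt C\to\mathtt{FVec}$ be a stem, let $\mathcal G$ be an $\mathcal S$-system on $X$ and let $c\in\mathtt C$. (i) For $\Psi\in\mathrm{Lin}(\mathcal S(c),X)$ the following are equivalent: (1) $\Psi\in\mathrm{CP}(\mathcal B_c,\mathcal G)$; (2) $(\Psi\otimes\mathrm{id}_{\mathcal S(c^* )})(\mathcal B_c(c^* ))\subseteq\mathcal G(c^* )$; (3) $(\Psi\otimes\mathrm{id}_{\mathcal S(c^* )})(m_{\mathcal S(c)})\in\mathcal G(c^* )$. (ii) For $\Psi\in\mathrm{Lin}(X,\mathcal S(c))$ the following are equivalent: (1) $\Psi\in\mathrm{CP}(\mathcal G,\mathcal A_c)$; (2) $(\Psi\otimes\mathrm{id}_{\mathcal S(c^* )})(\mathcal G(c^* ))\subseteq A(c\otimes c^* )$. In particular, if $\psi\in\mathrm{Pos}(\mathcal G(\mathbf 1^* ),A(\mathbf 1^* ))$, then $\psi\in\mathrm{CP}(\mathcal G,\mathcal A_{\mathbf 1})$.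
   Context: All vector spaces are finite-dimensional and real; $\mathtt{FVec}$ is the category of these with linear maps, $\mathrm{Lin}(V,W)$ is the space of linear maps, $V'=\mathrm{Lin}(V,\mathbb R)$. For convex cones $C\subseteq V$, $D\subseteq W$, $\mathrm{Pos}(C,D)=\{\Phi\in\mathrm{Lin}(V,W)\mid\Phi(C)\subseteq D\}$. The maximally entangled state of $V$ is $m_V=\sum_i v_i\otimes v_i'\in V\otimes V'$ for any basis $(v_i)$ of $V$ with dual basis $(v_i')$. A star autonomous category is a symmetric monoidal category $(\mathtt C,\otimes,\mathbf 1)$ with a full and faithful functor ${}^*\colon\mathtt C^{\mathrm{op}}\to\mathtt C$ and a natural bijection $\mathtt C(a\otimes b,c)\cong\mathtt C(a,(b\otimes c^* )^* )$. Write $a\mathbin{\check\otimes}b:=(a^*\otimes b^* )^*$. $\mathtt{FVec}$ is star autonomous with the usual tensor product and dual. A stem is a star autonomous functor $\mathcal S\colon\mathtt C\to\mathtt{FVec}$, where $\mathtt C$ is star autonomous: i.e. a strong monoidal functor with natural isomorphisms $\mathcal S(c^* )\cong\mathcal S(c)'$, such that $\mathcal S$ carries the bijection $\mathtt C(a\otimes b,c)\cong\mathtt C(a,(b\otimes c^* )^* )$ to the corresponding bijection in $\mathtt{FVec}$. These isomorphisms are written as equalities: $\mathcal S(\mathbf 1)=\mathbb R$, $\mathcal S(\mathbf 1^* )=\mathbb R'=\mathbb R$, $\mathcal S(c\otimes d)=\mathcal S(c)\otimes\mathcal S(d)=\mathcal S(c\mathbin{\check\otimes}d)$, $\mathcal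 S(c^* )=\mathcal S(c)'$; also $X\otimes\mathcal S(\mathbf 1^* )=X$, so that $\mathcal G(\mathbf 1^* )\subseteq X$ and $A(\mathbf 1^* )\subseteq\mathbb R$. For $c\in\mathtt C$: $A(c)=\{v\in\mathcal S(c)\mid\mathcal S(\varphi)(v)\ge 0\ \forall\varphi\in\mathtt C(c,\mathbf 1^* )\}$ and $B(c)=\overline{\mathrm{cone}}\{\mathcal S(\Phi)(1)\mid\Phi\in\mathtt C(\mathbf 1,c)\}$ (closed conic hull). An $\mathcal S$-system $\mathcal G$ on $X$ is a family of closed convex cones $\mathcal G(c)\subseteq X\otimes\mathcal S(c)$, $c\in\mathtt C$, with $(\mathrm{id}_X\otimes\mathcal S(\Phi))(\mathcal G(c))\subseteq\mathcal G(d)$ for all $\Phi\in\mathtt C(c,d)$. For $\mathcal S$-systems $\mathcal G$ on $X$ and $\mathcal E$ on $Y$, $\mathrm{CP}(\mathcal G,\mathcal E)$ is the set of $\Psi\in\mathrm{Lin}(X,Y)$ with $(\Psi\otimes\mathrm{id}_{\mathcal S(e)})(\mathcal G(e))\subseteq\mathcal E(e)$ for all $e\in\mathtt C$. The intrinsic system $\mathcal A_d$ and cointrinsic system $\mathcal B_d$ are the $\mathcal S$-systems on $\mathcal S(d)$ given by $\mathcal A_d(e)=A(d\otimes e)$ and $\mathcal B_d(e)=B(d\mathbin{\check\otimes}e)$, both inside $\mathcal S(d)\otimes\mathcal S(e)$. *)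

(* Defs.v *)
From HB Require Import structures.
From mathcomp Require Import all_boot all_order all_algebra.
From mathcomp Require Import all_classical reals topology normedtype.
Set Implicit Arguments.
Unset Strict Implicit.
Unset Printing Implicit Defensive.
Import Order.TTheory GRing.Theory Num.Theory numFieldNormedType.Exports.
Local Open Scope classical_set_scope.
Local Open Scope ring_scope.

Section Tensor.
Variable R : fieldType.
Implicit Types U V W : vectType R.

Definition dual V : vectType R := 'Hom(V, R^o).

(* Finite-dimensional model of V ⊗ W: v ⊗ w is the map f |-> f(v) w.  The
   universal property is lemma tensor_universal below. *)
Definition tensor V W : vectType R := 'Hom(dual V, W).

Definition ev (V : vectType R) (f : dual V) (v : V) : R :=
  (f : 'Hom(V, R^o)) v.

Definition vbas V (i : 'I_(\dim {:V})) : V := (vbasis {:V})`_i.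
Definition vcob V (i : 'I_(\dim {:V})) : dual V :=
  linfun (coord (vbasis {:V}) i : V -> R^o).

Definition tens V W (v : V) (w : W) : tensor V W :=
  linfun (fun f : dual V => ev f v *: w).

(* The linear map on V ⊗ W induced by b; only meaningful for bilinear b, for
   which tliftE gives tlift b (v ⊗ w) = b v w. *)
Definition tlift V W U (b : V -> W -> U) : 'Hom(tensor V W, U) :=
  linfun (fun t : tensor V W =>
            \sum_i b (vbas i) ((t : 'Hom(dual V, W)) (vcob i))).

Definition is_bilinear V W U (b : V -> W -> U) :=
  (forall v, linear (b v)) /\ (forall w, linear (b^~ w)).

Lemma evlP V (v : V) : linear ((@ev V)^~ v : dual V -> R^o).
Proof. by move=> a f g; rewrite /ev add_lfunE scale_lfunE. Qed.
Lemma evDl V (f g : dual V) v : ev (f + g) v = ev f v + ev g v.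
Proof. by rewrite /ev add_lfunE. Qed.
Lemma evZl V a (f : dual V) v : ev (a *: f) v = a * ev f v.
Proof. by rewrite /ev scale_lfunE. Qed.
Lemma evDr V (f : dual V) v w : ev f (v + w) = ev f v + ev f w.
Proof. by rewrite /ev linearD. Qed.
Lemma evZr V a (f : dual V) v : ev f (a *: v) = a * ev f v.
Proof. by rewrite /ev linearZ. Qed.

Lemma linfun_linearE V W (f : V -> W) : linear f -> linfun f =1 f.
Proof.
move=> lf v.
pose m := GRing.isLinear.Build R V W _ f lf.
pose F : {linear V -> W} := HB.pack f m.
by have -> : f = F by []; rewrite lfunE.
Qed.

Lemma tensE V W (v : V) (w : W) (f : dual V) :
  (tens v w : 'Hom(dual V, W)) f = ev f v *: w.
Proof.
rewrite linfun_linearE // => a g h.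
by rewrite evDl evZl scalerDl scalerA.
Qed.

Lemma vcobE V i (v : V) : ev (vcob i) v = coord (vbasis {:V}) i v.
Proof. by rewrite /ev lfunE. Qed.

Lemma vbasE V (v : V) : \sum_i ev (vcob i) v *: vbas i = v.
Proof.
rewrite [RHS](coord_vbasis (memvf v)).
by apply: eq_bigr => i _; rewrite vcobE.
Qed.

Lemma dualP V (f g : dual V) : (forall v, ev f v = ev g v) -> f = g.
Proof. by move=> e; apply/lfunP. Qed.

Lemma dualE V (f : dual V) : f = \sum_i ev f (vbas i) *: vcob i.
Proof.
apply: dualP => v; rewrite /ev sum_lfunE -{1}(vbasE v) linear_sum /=.
by apply: eq_bigr => i _; rewrite linearZ scale_lfunE; exact: mulrC.
Qed.

Lemma tens_bilin V W : is_bilinear (@tens V W).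
Proof.
split=> [v a w w'|w a v v']; apply/lfunP => f;
  rewrite add_lfunE scale_lfunE !tensE.
  by rewrite scalerDr !scalerA mulrC.
by rewrite evDr evZr scalerDl scalerA.
Qed.

Lemma tensDl V W (v v' : V) (w : W) : tens (v + v') w = tens v w + tens v' w.
Proof. by have := (tens_bilin V W).2 w 1 v v'; rewrite !scale1r. Qed.
Lemma tensDr V W (v : V) (w w' : W) : tens v (w + w') = tens v w + tens v w'.
Proof. by have := (tens_bilin V W).1 v 1 w w'; rewrite !scale1r. Qed.
Lemma tensZl V W a (v : V) (w : W) : tens (a *: v) w = a *: tens v w.
Proof. by apply/lfunP => f; rewrite scale_lfunE !tensE evZr scalerA. Qed.
Lemma tensZr V W a (v : V) (w : W) : tens v (a *: w) = a *: tens v w.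
Proof. by apply/lfunP => f; rewrite scale_lfunE !tensE !scalerA mulrC. Qed.

Lemma tensor_sum V W (t : tensor V W) :
  t = \sum_i tens (vbas i) ((t : 'Hom(dual V, W)) (vcob i)).
Proof.
apply/lfunP => f; rewrite sum_lfunE [in LHS](dualE f) linear_sum.
by apply: eq_bigr => i _; rewrite linearZ tensE.
Qed.

Lemma tensorP V W U (f g : 'Hom(tensor V W, U)) :
  (forall v w, f (tens v w) = g (tens v w)) -> f = g.
Proof.
move=> e; apply/lfunP => t; rewrite (tensor_sum t) !linear_sum.
by apply: eq_bigr => i _; apply: e.
Qed.

Lemma tliftE V W U (b : V -> W -> U) v w : is_bilinear b -> tlift b (tens v w) = b v w.
Proof.
case=> b1 b2; rewrite linfun_linearE; last first.
  move=> a t t'; rewrite scaler_sumr -big_split; apply: eq_bigr => i _.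
  by rewrite add_lfunE scale_lfunE b1.
pose m := GRing.isLinear.Build R V U _ (b^~ w) (b2 w).
pose F : {linear V -> U} := HB.pack (b^~ w) m.
rewrite -[RHS]/(F v) -[in RHS](vbasE v) linear_sum; apply: eq_bigr => i _.
rewrite tensE linearZ /=.
pose m' := GRing.isLinear.Build R W U _ (b (vbas i)) (b1 _).
pose F' : {linear W -> U} := HB.pack (b (vbas i)) m'.
by rewrite -[LHS]/(F' _) linearZ.
Qed.

Lemma tensor_universal V W U (b : V -> W -> U) : is_bilinear b ->
  exists! f : 'Hom(tensor V W, U), forall v w, f (tens v w) = b v w.
Proof.
move=> bb; exists (tlift b); split=> [v w|g e]; first exact: tliftE.
by apply: tensorP => v w; rewrite e tliftE.
Qed.
End Tensor.

Declare Scope cat_scope.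
Delimit Scope cat_scope with C.
Local Open Scope cat_scope.

Reserved Notation "g \oc f" (at level 50, left associativity).
Reserved Notation "a ⊗ b" (at level 40, left associativity).
Reserved Notation "f ⊗m g" (at level 40, left associativity).
Reserved Notation "a ^*" (at level 1, left associativity, format "a ^*").
Reserved Notation "f ^*m" (at level 1, left associativity, format "f ^*m").
Reserved Notation "a ⅋ b" (at level 40, left associativity).

Record category := Category {
  obj :> Type;
  mor : obj -> obj -> Type;
  idc : forall a, mor a a;
  compc : forall a b c, mor b c -> mor a b -> mor a c;
  compc1l : forall a b (f : mor a b), compc (idc b) f = f;
  compc1r : forall a b (f : mor a b), compc f (idc a) = f;
  compcA : forall a b c d (h : mor c d) (g : mor b c) (f : mor a b),
    compc h (compc g f) = compc (compc h g) f }.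
Arguments mor {_} _ _.
Arguments idc {_} a.
Arguments compc {_ a b c} _ _.
Notation "g \oc f" := (compc g f) : cat_scope.

Record iso (C : category) (a b : C) := Iso {
  fwd : mor a b;
  bwd : mor b a;
  fwdK : bwd \oc fwd = idc a;
  bwdK : fwd \oc bwd = idc b }.

Record symMonCat := SymMonCat {
  smc_cat :> category;
  unitc : smc_cat;
  tob : smc_cat -> smc_cat -> smc_cat;
  tmor : forall a a' b b' : smc_cat,
    mor a a' -> mor b b' -> mor (tob a b) (tob a' b');
  assoc : forall a b c, iso (tob (tob a b) c) (tob a (tob b c));
  lunit : forall a, iso (tob unitc a) a;
  runit : forall a, iso (tob a unitc) a;
  braid : forall a b, mor (tob a b) (tob b a);
  tmor_id : forall a b, tmor (idc a) (idc b) = idc (tob a b);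
  tmor_comp : forall a a' a'' b b' b'' (f' : mor a' a'') (f : mor a a')
      (g' : mor b' b'') (g : mor b b'),
    tmor (f' \oc f) (g' \oc g) = tmor f' g' \oc tmor f g;
  assoc_nat : forall a a' b b' c c'
      (f : mor a a') (g : mor b b') (h : mor c c'),
    fwd (assoc a' b' c') \oc tmor (tmor f g) h
    = tmor f (tmor g h) \oc fwd (assoc a b c);
  lunit_nat : forall a a' (f : mor a a'),
    fwd (lunit a') \oc tmor (idc unitc) f = f \oc fwd (lunit a);
  runit_nat : forall a a' (f : mor a a'),
    fwd (runit a') \oc tmor f (idc unitc) = f \oc fwd (runit a);
  braid_nat : forall a a' b b' (f : mor a a') (g : mor b b'),
    braid a' b' \oc tmor f g = tmor g f \oc braid a b;
  triangle : forall a b,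
    tmor (idc a) (fwd (lunit b)) \oc fwd (assoc a unitc b)
    = tmor (fwd (runit a)) (idc b);
  pentagon : forall a b c d,
    fwd (assoc a b (tob c d)) \oc fwd (assoc (tob a b) c d)
    = tmor (idc a) (fwd (assoc b c d)) \oc fwd (assoc a (tob b c) d)
        \oc tmor (fwd (assoc a b c)) (idc d);
  hexagon : forall a b c,
    fwd (assoc b c a) \oc braid a (tob b c) \oc fwd (assoc a b c)
    = tmor (idc b) (braid a c) \oc fwd (assoc b a c)
        \oc tmor (braid a b) (idc c);
  braidK : forall a b, braid b a \oc braid a b = idc (tob a b) }.
Arguments unitc {_}.
Arguments tob {_} _ _.
Arguments tmor {_ _ _ _ _} _ _.
Notation "a ⊗ b" := (tob a b) : cat_scope.
Notation "f ⊗m g" := (tmor f g) : cat_scope.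

(* Barr's definition: adj is the bijection C(a ⊗ b, c) ~ C(a, (b ⊗ c^* )^* ),
   natural in a, b and c; starm_bij says that the contravariant functor star is
   full and faithful. *)
Record starAutCat := StarAutCat {
  sac_smc :> symMonCat;
  star : sac_smc -> sac_smc;
  starm : forall a b : sac_smc, mor a b -> mor (star b) (star a);
  adj : forall a b c : sac_smc, mor (a ⊗ b) c -> mor a (star (b ⊗ star c));
  starm_id : forall a, starm (idc a) = idc (star a);
  starm_comp : forall a b c (g : mor b c) (f : mor a b),
    starm (g \oc f) = starm f \oc starm g;
  starm_bij : forall a b, bijective (@starm a b);
  adj_bij : forall a b c, bijective (@adj a b c);
  adj_nat : forall a a' b b' c c'
      (f : mor a' a) (g : mor b' b) (h : mor c c') (p : mor (a ⊗ b) c),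
    adj (h \oc p \oc (f ⊗m g))
    = starm (g ⊗m starm h) \oc adj p \oc f }.
Arguments star {_} _.
Arguments starm {_ _ _} _.
Arguments adj {_ _ _ _} _.
Notation "a ^*" := (star a) : cat_scope.
Notation "f ^*m" := (starm f) : cat_scope.

Definition par (C : starAutCat) (a b : C) : C := (a^* ⊗ b^*)^*.
Notation "a ⅋ b" := (par a b) : cat_scope.

Record functor (C D : category) := Functor {
  fob :> C -> D;
  fmor : forall a b : C, mor a b -> mor (fob a) (fob b);
  fmor_id : forall a, fmor (idc a) = idc (fob a);
  fmor_comp : forall a b c (g : mor b c) (f : mor a b),
    fmor (g \oc f) = fmor g \oc fmor f }.
Arguments fmor {_ _} _ {_ _} _.

(* Preservation of the braiding is not required. *)
Record strongMonFunctor (C D : symMonCat) := StrongMonFunctor {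
  smf_functor :> functor C D;
  feps : iso unitc (smf_functor unitc);
  fmu : forall a b, iso (smf_functor a ⊗ smf_functor b) (smf_functor (a ⊗ b));
  fmu_nat : forall a a' b b' (f : mor a a') (g : mor b b'),
    fwd (fmu a' b') \oc (fmor smf_functor f ⊗m fmor smf_functor g)
    = fmor smf_functor (f ⊗m g) \oc fwd (fmu a b);
  fmu_assoc : forall a b c,
    fmor smf_functor (fwd (assoc a b c)) \oc fwd (fmu (a ⊗ b) c)
      \oc (fwd (fmu a b) ⊗m idc _)
    = fwd (fmu a (b ⊗ c)) \oc (idc _ ⊗m fwd (fmu b c)) \oc fwd (assoc _ _ _);
  fmu_lunit : forall a,
    fmor smf_functor (fwd (lunit a)) \oc fwd (fmu unitc a)
      \oc (fwd feps ⊗m idc _)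
    = fwd (lunit _);
  fmu_runit : forall a,
    fmor smf_functor (fwd (runit a)) \oc fwd (fmu a unitc)
      \oc (idc _ ⊗m fwd feps)
    = fwd (runit _) }.
Arguments feps {_ _} _.
Arguments fmu {_ _} _ _ _.

(* fadj: S (adj p) corresponds to adj (S p) under the identification
   S ((b ⊗ c^* )^* ) = S (b ⊗ c^* )^* = (S b ⊗ (S c)^* )^* given by fnu and fmu. *)
Record starFunctor (C D : starAutCat) := StarFunctor {
  sf_smf :> strongMonFunctor C D;
  fnu : forall a, iso (sf_smf a^*) (sf_smf a)^*;
  fnu_nat : forall a b (f : mor a b),
    fwd (fnu a) \oc fmor sf_smf f^*m = (fmor sf_smf f)^*m \oc fwd (fnu b);
  fadj : forall a b c (p : mor (a ⊗ b) c),
    (fwd (fmu sf_smf b c^*) \oc (idc _ ⊗m bwd (fnu c)))^*m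
      \oc fwd (fnu (b ⊗ c^*)) \oc fmor sf_smf (adj p)
    = adj (fmor sf_smf p \oc fwd (fmu sf_smf a b)) }.
Arguments fnu {_ _} _ _.

Section FVec.
Variable R : fieldType.
Implicit Types U V W X Y : vectType R.

Lemma tlift_comb V W U a (b b1 b2 : V -> W -> U) t :
  (forall v w, b v w = a *: b1 v w + b2 v w) -> is_bilinear b1 -> is_bilinear b2 ->
  tlift b t = a *: tlift b1 t + tlift b2 t.
Proof.
move=> e bb1 bb2; rewrite -scale_lfunE -add_lfunE; congr fun_of_lfun.
apply: tensorP => v w; rewrite add_lfunE scale_lfunE !tliftE ?e //.
case: bb1 bb2 => b11 b12 [b21 b22].
split=> [x y z s|x y z s] /=; rewrite !e (b11, b12) (b21, b22).
  by rewrite !scalerDr !scalerA mulrC addrACA.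
by rewrite !scalerDr !scalerA mulrC addrACA.
Qed.

Definition tmap V V' W W' (f : 'Hom(V, V')) (g : 'Hom(W, W')) :
    'Hom(tensor V W, tensor V' W') :=
  tlift (fun v w => tens (f v) (g w)).

Lemma tmapE V V' W W' (f : 'Hom(V, V')) (g : 'Hom(W, W')) v w :
  tmap f g (tens v w) = tens (f v) (g w).
Proof.
rewrite tliftE //; split=> [x a y z|x a y z] /=; rewrite linearP.
  by rewrite tensDr tensZr.
by rewrite tensDl tensZl.
Qed.

Definition vassoc U V W :
    'Hom(tensor (tensor U V) W, tensor U (tensor V W)) :=
  tlift (fun s w => tlift (fun u v => tens u (tens v w)) s).
Definition vassocV U V W :
    'Hom(tensor U (tensor V W), tensor (tensor U V) W) :=
  tlift (fun u s => tlift (fun v w => tens (tens u v) w) s).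

Lemma vassoc_subproof U V W (w : W) :
  is_bilinear (fun (u : U) (v : V) => tens u (tens v w)).
Proof.
by split=> [x a y z|x a y z] /=; rewrite !(tensDl, tensZl, tensDr, tensZr).
Qed.
Lemma vassocV_subproof U V W (u : U) :
  is_bilinear (fun (v : V) (w : W) => tens (tens u v) w).
Proof.
by split=> [x a y z|x a y z] /=; rewrite !(tensDl, tensZl, tensDr, tensZr).
Qed.

Lemma vassocE U V W (u : U) (v : V) (w : W) :
  vassoc U V W (tens (tens u v) w) = tens u (tens v w).
Proof.
rewrite tliftE; first by rewrite tliftE //; apply: vassoc_subproof.
split=> [s a y z|s a y z] /=; last by rewrite linearP.
by apply: tlift_comb => [u' v'||]; [|exact: vassoc_subproof..];
  rewrite !(tensDl, tensZl, tensDr, tensZr).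
Qed.

Lemma vassocVE U V W (u : U) (v : V) (w : W) :
  vassocV U V W (tens u (tens v w)) = tens (tens u v) w.
Proof.
rewrite tliftE; first by rewrite tliftE //; apply: vassocV_subproof.
split=> [s a y z|s a y z] /=; first by rewrite linearP.
by apply: tlift_comb => [u' v'||]; [|exact: vassocV_subproof..];
  rewrite !(tensDl, tensZl, tensDr, tensZr).
Qed.

Definition vlunit V : 'Hom(tensor R^o V, V) := tlift (fun (a : R^o) v => a *: v).
Definition vlunitV V : 'Hom(V, tensor R^o V) :=
  linfun (fun v : V => tens (1 : R^o) v).
Definition vrunit V : 'Hom(tensor V R^o, V) := tlift (fun v (a : R^o) => a *: v).
Definition vrunitV V : 'Hom(V, tensor V R^o) :=
  linfun (fun v : V => tens v (1 : R^o)).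
Definition vbraid V W : 'Hom(tensor V W, tensor W V) :=
  tlift (fun v w => tens w v).

Lemma vlunitE V (a : R^o) (v : V) : vlunit V (tens a v) = a *: v.
Proof.
rewrite tliftE //; split=> [x b y z|x b y z] /=.
  by rewrite scalerDr !scalerA mulrC.
by rewrite scalerDl scalerA.
Qed.
Lemma vrunitE V (a : R^o) (v : V) : vrunit V (tens v a) = a *: v.
Proof.
rewrite tliftE //; split=> [x b y z|x b y z] /=.
  by rewrite scalerDl scalerA.
by rewrite scalerDr !scalerA mulrC.
Qed.
Lemma vlunitVE V (v : V) : vlunitV V v = tens (1 : R^o) v.
Proof. by rewrite linfun_linearE // => a x y; rewrite tensDr tensZr. Qed.
Lemma vrunitVE V (v : V) : vrunitV V v = tens v (1 : R^o).
Proof. by rewrite linfun_linearE // => a x y; rewrite tensDl tensZl. Qed.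
Lemma vbraidE V W (v : V) (w : W) : vbraid V W (tens v w) = tens w v.
Proof.
by rewrite tliftE //; split=> [x a y z|x a y z] /=;
  rewrite !(tensDl, tensZl, tensDr, tensZr).
Qed.

Definition vdual V W (f : 'Hom(V, W)) : 'Hom(dual W, dual V) :=
  linfun (fun g : dual W => ((g : 'Hom(W, R^o)) \o f)%VF : dual V).

Lemma vdualE V W (f : 'Hom(V, W)) (g : dual W) v :
  ev (vdual f g) v = ev g (f v).
Proof.
rewrite linfun_linearE; first by rewrite /ev comp_lfunE.
by move=> a x y; rewrite /= comp_lfunDl comp_lfunZl.
Qed.

(* The element v is sent to the functional w ⊗ f |-> f (p (v ⊗ w)). *)
Definition vadj V W U (p : 'Hom(tensor V W, U)) :
    'Hom(V, dual (tensor W (dual U))) :=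
  linfun (fun v : V => tlift (fun w (f : dual U) => ev f (p (tens v w)) : R^o)
                       : dual (tensor W (dual U))).

Lemma vadj_subproof V W U (p : 'Hom(tensor V W, U)) (v : V) :
  is_bilinear (fun w (f : dual U) => ev f (p (tens v w)) : R^o).
Proof.
split=> [w a f g|f a w w'] /=; first by rewrite evDl evZl.
by rewrite tensDr tensZr linearP evDr evZr.
Qed.

Lemma vadjE V W U (p : 'Hom(tensor V W, U)) v w (f : dual U) :
  ev (vadj p v) (tens w f) = ev f (p (tens v w)).
Proof.
rewrite linfun_linearE; first by rewrite [LHS]tliftE //; apply: vadj_subproof.
move=> a x y; apply: tensorP => w' g.
rewrite add_lfunE scale_lfunE !tliftE; try exact: vadj_subproof.
by rewrite tensDl tensZl linearP evDr evZr.
Qed.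

Lemma bidualP V (v w : V) : (forall f : dual V, ev f v = ev f w) -> v = w.
Proof.
move=> e; rewrite -(vbasE v) -(vbasE w).
by apply: eq_bigr => i _; rewrite e.
Qed.

Lemma vdual_bij V W : bijective (@vdual V W).
Proof.
exists (fun F : 'Hom(dual W, dual V) =>
  linfun (fun v : V => \sum_i ev (F (vcob i)) v *: vbas i)).
  move=> f; apply/lfunP => v; rewrite linfun_linearE; last first.
    move=> a x y; rewrite scaler_sumr -big_split; apply: eq_bigr => i _ /=.
    by rewrite evDr evZr scalerDl scalerA.
  rewrite -[RHS]vbasE; apply: eq_bigr => i _; congr (_ *: _).
  exact: vdualE.
move=> F; apply/lfunP => g; apply: dualP => v.
rewrite vdualE linfun_linearE; last first.
  move=> a x y; rewrite scaler_sumr -big_split; apply: eq_bigr => i _ /=.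
  by rewrite evDr evZr scalerDl scalerA.
rewrite [in RHS](dualE g) linear_sum /ev sum_lfunE linear_sum.
apply: eq_bigr => i _; rewrite !linearZ scale_lfunE; exact: mulrC.
Qed.

Lemma vadj_bij V W U : bijective (@vadj V W U).
Proof.
pose G (q : 'Hom(V, dual (tensor W (dual U)))) : 'Hom(tensor V W, U) :=
  tlift (fun v w => \sum_i ev (q v) (tens w (vcob i)) *: vbas i).
have GE q v w : G q (tens v w) = \sum_i ev (q v) (tens w (vcob i)) *: vbas i.
  rewrite tliftE //; split=> [x a y z|x a y z] /=;
    rewrite scaler_sumr -big_split; apply: eq_bigr => i _ /=.
    by rewrite tensDl tensZl evDr evZr scalerDl scalerA.
  by rewrite linearP evDl evZl scalerDl scalerA.
exists G => [p|q].
  apply: tensorP => v w; rewrite GE -[RHS]vbasE.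
  by apply: eq_bigr => i _; rewrite vadjE.
apply/lfunP => v; apply: tensorP => w f.
rewrite -[LHS]/(ev (vadj (G q) v) (tens w f)) vadjE GE.
rewrite -[RHS]/(ev (q v) (tens w f)) [in RHS](dualE f).
rewrite /ev !linear_sum.
have -> : tens w (\sum_i (f : 'Hom(U, R^o)) (vbas i) *: vcob i)
  = \sum_i (f : 'Hom(U, R^o)) (vbas i) *: tens w (vcob i).
  pose m := GRing.isLinear.Build R _ _ _ (tens w) ((tens_bilin W (dual U)).1 w).
  pose T : {linear dual U -> tensor W (dual U)} := HB.pack (tens w) m.
  rewrite -[LHS]/(T _) linear_sum; apply: eq_bigr => i _.
  by rewrite linearZ.
rewrite linear_sum; apply: eq_bigr => i _; rewrite !linearZ; exact: mulrC.
Qed.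


Lemma tens_fixr V W (w : W) : exists T : 'Hom(V, tensor V W), forall v, T v = tens v w.
Proof.
exists (linfun (fun v => tens v w)) => v.
by rewrite linfun_linearE // => a x y; rewrite tensDl tensZl.
Qed.

Lemma tens_fixl V W (v : V) : exists T : 'Hom(W, tensor V W), forall w, T w = tens v w.
Proof.
exists (linfun (fun w => tens v w)) => w.
by rewrite linfun_linearE // => a x y; rewrite tensDr tensZr.
Qed.

Lemma tensor3lP U V W X (f g : 'Hom(tensor (tensor U V) W, X)) :
  (forall u v w, f (tens (tens u v) w) = g (tens (tens u v) w)) -> f = g.
Proof.
move=> e; apply: tensorP => s w; have [T TE] := @tens_fixr (tensor U V) W w.
rewrite -!TE -!comp_lfunE; congr fun_of_lfun; apply: tensorP => u v.
by rewrite !comp_lfunE !TE.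
Qed.

Lemma tensor3rP U V W X (f g : 'Hom(tensor U (tensor V W), X)) :
  (forall u v w, f (tens u (tens v w)) = g (tens u (tens v w))) -> f = g.
Proof.
move=> e; apply: tensorP => u s; have [T TE] := @tens_fixl U (tensor V W) u.
rewrite -!TE -!comp_lfunE; congr fun_of_lfun; apply: tensorP => v w.
by rewrite !comp_lfunE !TE.
Qed.

Lemma tensor4lP U V W X Y (f g : 'Hom(tensor (tensor (tensor U V) W) X, Y)) :
  (forall u v w x, f (tens (tens (tens u v) w) x)
                   = g (tens (tens (tens u v) w) x)) -> f = g.
Proof.
move=> e; apply: tensorP => s w.
have [T TE] := @tens_fixr (tensor (tensor U V) W) X w.
rewrite -!TE -!comp_lfunE; congr fun_of_lfun; apply: tensor3lP => u v x.
by rewrite !comp_lfunE !TE.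
Qed.

Definition FVec_cat : category :=
  @Category (vectType R) (fun V W => 'Hom(V, W)) (fun V => \1%VF)
    (fun U V W g f => (g \o f)%VF)
    (fun V W f => comp_lfun1l f) (fun V W f => comp_lfun1r f)
    (fun U V W X h g f => comp_lfunA h g f).

Let tE := (comp_lfunE, id_lfunE, tmapE, vassocE, vassocVE, vlunitE,
  vrunitE, vlunitVE, vrunitVE, vbraidE).

Definition vassoc_iso U V W :
  @iso FVec_cat (tensor (tensor U V) W) (tensor U (tensor V W)).
Proof.
by apply: (@Iso FVec_cat _ _ (vassoc U V W) (vassocV U V W));
  [apply: tensor3lP|apply: tensor3rP] => u v w; rewrite /= !tE.
Defined.

Definition vlunit_iso V : @iso FVec_cat (tensor R^o V) V.
Proof.
apply: (@Iso FVec_cat _ _ (vlunit V) (vlunitV V)).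
  by apply: (@tensorP R R^o V _) => a v; rewrite /= !tE tensZr -tensZl; congr tens; exact: mulr1.
by apply/lfunP => v; rewrite /= !tE scale1r.
Defined.

Definition vrunit_iso V : @iso FVec_cat (tensor V R^o) V.
Proof.
apply: (@Iso FVec_cat _ _ (vrunit V) (vrunitV V)).
  by apply: (@tensorP R V R^o _) => v a; rewrite /= !tE tensZl -tensZr; congr tens; exact: mulr1.
by apply/lfunP => v; rewrite /= !tE scale1r.
Defined.

Definition FVec_smc : symMonCat.
Proof.
apply: (@SymMonCat FVec_cat R^o (@tensor R) tmap vassoc_iso vlunit_iso
  vrunit_iso vbraid) => /=.
- by move=> V W; apply: tensorP => v w; rewrite !tE.
- by move=> a a' a'' b b' b'' f' f g' g; apply: tensorP => v w; rewrite !tE.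
- by move=> a a' b b' c c' f g h; apply: tensor3lP => u v w; rewrite !tE.
- by move=> a a' f; apply: tensorP => v w; rewrite !tE linearZ.
- by move=> a a' f; apply: tensorP => v w; rewrite !tE linearZ.
- by move=> a a' b b' f g; apply: tensorP => v w; rewrite !tE.
- by move=> a b; apply: tensor3lP => u v w; rewrite !tE tensZl tensZr.
- by move=> a b c d; apply: tensor4lP => u v w x; rewrite !tE.
- by move=> a b c; apply: tensor3lP => u v w; rewrite !tE.
- by move=> a b; apply: tensorP => v w; rewrite !tE.
Defined.

Definition FVec : starAutCat.
Proof.
apply: (@StarAutCat FVec_smc (@dual R) vdual vadj) => /=.
- by move=> a; apply/lfunP => f; apply: dualP => v; rewrite vdualE !tE.
- by move=> a b c g f; apply/lfunP => h; apply: dualP => v; rewrite !tE !vdualE tE.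
- exact: vdual_bij.
- exact: vadj_bij.
- move=> a a' b b' c c' f g h p; apply/lfunP => v; apply: tensorP => w k.
  rewrite -[LHS]/(ev (vadj (h \o p \o tmap f g) v) (tens w k)).
  rewrite vadjE !tE.
  rewrite -[RHS]/(ev (vdual (tmap g (vdual h)) (vadj p (f v))) (tens w k)).
  by rewrite !(vdualE, tE, vadjE).
Defined.

End FVec.

Section Dim.
Variable R : fieldType.
Implicit Types V W : vectType R.

(* Independent of the basis: see maxent_basis. *)
Definition maxent V : tensor V (dual V) := \sum_i tens (vbas i) (vcob i).

Lemma maxent_basis V (n : nat) (e : n.-tuple V) : basis_of fullv e ->
  maxent V = \sum_(i < n) tens e`_i (linfun (coord e i : V -> R^o) : dual V).
Proof.
move=> eb.
have mE (f : dual V) : (maxent V : 'Hom(dual V, dual V)) f = f.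
  rewrite [RHS](dualE f) sum_lfunE; apply: eq_bigr => i _.
  by rewrite tensE.
apply/lfunP => f; rewrite mE; apply: dualP => v.
rewrite /ev sum_lfunE sum_lfunE.
rewrite {1}(coord_basis eb (memvf v)) linear_sum; apply: eq_bigr => i _.
by rewrite tensE scale_lfunE lfunE linearZ; exact: mulrC.
Qed.

Lemma tens_suml V W I (r : seq I) (F : I -> V) (w : W) :
  tens (\sum_(i <- r) F i) w = \sum_(i <- r) tens (F i) w.
Proof.
have [T TE] := @tens_fixr R V W w.
by rewrite -TE linear_sum; apply: eq_bigr => i _; exact: TE.
Qed.
Lemma tens_sumr V W I (r : seq I) (v : V) (F : I -> W) :
  tens v (\sum_(i <- r) F i) = \sum_(i <- r) tens v (F i).
Proof.
have [T TE] := @tens_fixl R V W v.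
by rewrite -TE linear_sum; apply: eq_bigr => i _; exact: TE.
Qed.
Lemma ev_suml V I (r : seq I) (F : I -> dual V) v :
  ev (\sum_(i <- r) F i) v = \sum_(i <- r) ev (F i) v.
Proof. by rewrite /ev sum_lfunE. Qed.
Lemma ev_sumr V I (r : seq I) (f : dual V) (F : I -> V) :
  ev f (\sum_(i <- r) F i) = \sum_(i <- r) ev f (F i).
Proof. by rewrite /ev linear_sum. Qed.

Lemma tens_sum2 V W (I J : finType) (a : I -> R) (b : J -> R)
    (F : I -> V) (H : J -> W) :
  tens (\sum_i a i *: F i) (\sum_j b j *: H j)
  = \sum_i \sum_j (a i * b j) *: tens (F i) (H j).
Proof.
rewrite tens_suml; apply: eq_bigr => i _; rewrite tens_sumr.
by apply: eq_bigr => j _; rewrite tensZl tensZr scalerA.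
Qed.

Lemma tens_sum V W (v : V) (w : W) : tens v w
  = \sum_i \sum_j (ev (vcob i) v * ev (vcob j) w) *: tens (vbas i) (vbas j).
Proof. by rewrite -tens_sum2 !vbasE. Qed.

(* The canonical identification of V ⊗ W with V ⅋ W in FVec (an isomorphism by
   vpar_bij). *)
Definition vpar V W : 'Hom(tensor V W, dual (tensor (dual V) (dual W))) :=
  tlift (fun v w =>
    tlift (fun (f : dual V) (g : dual W) => ev f v * ev g w : R^o)
    : dual (tensor (dual V) (dual W))).

Lemma vpar_subproof V W (v : V) (w : W) :
  is_bilinear (fun (f : dual V) (g : dual W) => ev f v * ev g w : R^o).
Proof.
split=> [f a g g'|g a f f'] /=; rewrite evDl evZl.
  rewrite mulrDr mulrCA; congr (_ + _).
by rewrite mulrDl -mulrA.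
Qed.

Lemma vparE V W (v : V) (w : W) (f : dual V) (g : dual W) :
  ev (vpar V W (tens v w)) (tens f g) = ev f v * ev g w.
Proof.
rewrite tliftE; first by rewrite [LHS]tliftE //; exact: vpar_subproof.
split=> [x a y z|x a y z] /=; apply: tensorP => f' g';
  rewrite add_lfunE scale_lfunE !tliftE; try exact: vpar_subproof.
  by rewrite evDr evZr mulrDr mulrCA.
by rewrite evDr evZr mulrDl -mulrA.
Qed.

Lemma vpar_bij V W : bijective (vpar V W).
Proof.
pose G (s : dual (tensor (dual V) (dual W))) : tensor V W :=
  \sum_i \sum_j ev s (tens (vcob i) (vcob j)) *: tens (vbas i) (vbas j).
have GD a x y : G (a *: x + y) = a *: G x + G y.
  rewrite /G scaler_sumr -big_split; apply: eq_bigr => i _ /=.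
  rewrite scaler_sumr -big_split; apply: eq_bigr => j _ /=.
  by rewrite evDl evZl scalerDl scalerA.
exists G.
  move=> t.
  rewrite -(linfun_linearE GD) -comp_lfunE -[RHS]id_lfunE; congr fun_of_lfun.
  apply: tensorP => v w; rewrite comp_lfunE linfun_linearE // id_lfunE.
  rewrite [RHS]tens_sum /G; apply: eq_bigr => i _; apply: eq_bigr => j _.
  by rewrite vparE.
move=> s; apply: tensorP => f g.
rewrite -[LHS]/(ev (vpar V W (G s)) (tens f g)) -[RHS]/(ev s (tens f g)).
rewrite [in RHS](dualE f) [in RHS](dualE g) [tens _ _ in RHS]tens_sum2 ev_sumr.
rewrite /G linear_sum ev_suml; apply: eq_bigr => i _.
rewrite linear_sum ev_suml ev_sumr; apply: eq_bigr => j _.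
by rewrite linearZ evZl vparE evZr mulrC.
Qed.
End Dim.

Section Cones.
Variable R : realType.
Implicit Types V W : vectType R.

Definition vcoord V : V -> 'rV[R]_(\dim {:V}) := passmx.rVof (vbasis {:V}).
Definition vofcoord V : 'rV[R]_(\dim {:V}) -> V := passmx.vecof (vbasis {:V}).

(* A vectType carries no topology in the library; its Euclidean topology is the
   one transported from 'rV[R]_n along the coordinates in a basis. *)
Definition closedv V (A : set V) := closed (@vofcoord V @^-1` A).
Definition closurev V (A : set V) : set V :=
  @vcoord V @^-1` closure (@vofcoord V @^-1` A).

(* Cones are nonempty, hence contain 0; in particular conic_hull set0 is {0}. *)
Definition convex_cone V (A : set V) :=
  [/\ A 0, forall x y, A x -> A y -> A (x + y)
    & forall (a : R) x, 0 <= a -> A x -> A (a *: x)].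

Definition conic_hull V (A : set V) : set V :=
  [set v | exists n (a : 'I_n -> R) (x : 'I_n -> V),
     [/\ forall i, 0 <= a i, forall i, A (x i) & v = \sum_i a i *: x i]].

Definition Pos V W (C : set V) (D : set W) : set 'Hom(V, W) :=
  [set f | f @` C `<=` D].

Lemma vcoord_linear V : linear (@vcoord V).
Proof. exact: passmx.rVof_linear. Qed.
Lemma vofcoord_linear V : linear (@vofcoord V).
Proof. exact: passmx.vecof_linear. Qed.
Lemma vcoordK V : cancel (@vcoord V) (@vofcoord V).
Proof. exact: (passmx.rVofK (vbasisP _)). Qed.
Lemma vofcoordK V : cancel (@vofcoord V) (@vcoord V).
Proof. exact: (passmx.vecofK (vbasisP _)). Qed.

Lemma rV_linear_continuous n (W : normedModType R) (f : {linear 'rV[R]_n -> W}) :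
  continuous f.
Proof.
have -> : (f : 'rV[R]_n -> W) = fun x => \sum_k x 0 k *: f (delta_mx 0 k).
  apply/funext => x; rewrite {1}(row_sum_delta x) linear_sum.
  by apply: eq_bigr => k _; rewrite linearZ.
move=> x.
have Fx : Filter (nbhs x) := nbhs_filter x.
apply: (@cvg_big W _ _ 0 _ _ _ (nbhs x)) => [|k _]; first exact: add_continuous.
by apply: (@cvgZr_tmp _ _ _ (nbhs x) Fx); exact: coord_continuous.
Qed.

Lemma closedv_preim V W (f : 'Hom(V, W)) (B : set W) :
  closedv B -> closedv (f @^-1` B).
Proof.
move=> cB; rewrite /closedv.
have fl : linear (fun x => vcoord (f (vofcoord x))).
  by move=> a x y; rewrite vofcoord_linear linearP vcoord_linear.
pose m := GRing.isLinear.Build R 'rV[R]_(\dim {:V}) 'rV[R]_(\dim {:W}) _ _ fl.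
pose F : {linear 'rV[R]_(\dim {:V}) -> 'rV[R]_(\dim {:W})} :=
  HB.pack (fun x => vcoord (f (vofcoord x))) m.
have -> : @vofcoord V @^-1` (f @^-1` B) = F @^-1` (@vofcoord W @^-1` B).
  by apply/seteqP; split=> x; rewrite /= vcoordK.
by apply: preimage_closed => // x _; exact: rV_linear_continuous.
Qed.

Lemma closedv_closurev V (A : set V) : closedv (closurev A).
Proof.
rewrite /closedv /closurev.
have -> : @vofcoord V @^-1` (@vcoord V @^-1` closure (@vofcoord V @^-1` A))
  = closure (@vofcoord V @^-1` A).
  by apply/seteqP; split=> x; rewrite /= vofcoordK.
exact: closed_closure.
Qed.

Lemma sub_closurev V (A : set V) : A `<=` closurev A.
Proof. by move=> v Av; apply: subset_closure; rewrite /= vcoordK. Qed.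

Lemma closurev_min V (A B : set V) : A `<=` B -> closedv B ->
  closurev A `<=` B.
Proof.
move=> AB cB v; rewrite /closurev /= closureEbigcap.
by move=> /(_ (@vofcoord V @^-1` B)); rewrite /= vcoordK; apply; split=> // x; exact: AB.
Qed.

Lemma closedv_shift V (A : set V) (w : V) : closedv A ->
  closedv [set v | A (v + w)].
Proof.
move=> cA; rewrite /closedv.
have -> : @vofcoord V @^-1` [set v | A (v + w)]
  = (fun x => x + vcoord w) @^-1` (@vofcoord V @^-1` A).
  by apply/seteqP; split=> x; 
    have := vofcoord_linear 1 x (vcoord w); rewrite /= !scale1r vcoordK => ->.
apply: preimage_closed => // x _.
have Fx : Filter (nbhs x) := nbhs_filter x.
by apply: (@cvgD _ _ _ (nbhs x) Fx id (cst (vcoord w))); [exact: cvg_id|exact: cvg_cst].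
Qed.

Lemma closedv_bigcap V I (F : I -> set V) :
  (forall i, closedv (F i)) -> closedv [set v | forall i, F i v].
Proof.
move=> cF; rewrite /closedv.
have -> : @vofcoord V @^-1` [set v | forall i, F i v]
  = \bigcap_(i in [set: I]) (@vofcoord V @^-1` F i).
  by apply/seteqP; split=> x /= Fx i; [move=> _|]; exact: Fx.
by apply: closed_bigI => i _; exact: cF.
Qed.

Lemma closedv_ge0 V (f : 'Hom(V, R^o)) : closedv [set v | 0 <= f v :> R].
Proof.
rewrite /closedv.
have fl : linear (fun x => f (vofcoord x)) by move=> a x y; rewrite vofcoord_linear linearP.
pose m := GRing.isLinear.Build R 'rV[R]_(\dim {:V}) R^o _ _ fl.
pose F : {linear 'rV[R]_(\dim {:V}) -> R^o} := HB.pack (fun x => f (vofcoord x)) m.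
rewrite -[X in closed X]/(F @^-1` [set x : R | 0 <= x]).
by apply: preimage_closed => [x _|]; [exact: rV_linear_continuous|exact: closed_ge].
Qed.

Lemma closurev_cone V (A : set V) : convex_cone A -> convex_cone (closurev A).
Proof.
case=> A0 AD AZ; split=> [|x y Ax Ay|a x a0 Ax]; first exact: sub_closurev.
- suff /(_ _ Ax) : closurev A `<=` [set v | closurev A (v + y)] by [].
  apply: closurev_min => [x' Ax' /=|]; last by apply: closedv_shift; apply: closedv_closurev.
  suff /(_ _ Ay) : closurev A `<=` [set v | closurev A (v + x')].
    by rewrite /= addrC.
  apply: closurev_min => [y' Ay' /=|]; last by apply: closedv_shift; apply: closedv_closurev.
  by apply: sub_closurev; exact: AD.
- pose f : 'Hom(V, V) := a *: \1%VF.
  have fE v : f v = a *: v by rewrite scale_lfunE id_lfunE.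
  rewrite -fE; suff /(_ _ Ax) : closurev A `<=` f @^-1` closurev A by [].
  apply: closurev_min => [x' Ax' /=|]; last by apply: closedv_preim; apply: closedv_closurev.
  by rewrite fE; apply: sub_closurev; exact: AZ.
Qed.

Lemma conic_hull_cone V (A : set V) : convex_cone (conic_hull A).
Proof.
split.
- exists 0, (fun=> 0), (fun=> 0); split=> [i|[]//|]; first exact: lexx.
  by rewrite big_ord0.
- move=> _ _ [n [a [x [a0 Ax ->]]]] [m [b [y [b0 Ay ->]]]].
  exists (n + m)%N, (fun i : 'I_(n + m) => match fintype.split i with inl j => a j | inr j => b j end),
    (fun i : 'I_(n + m) => match fintype.split i with inl j => x j | inr j => y j end).
  split=> [i|i|]; [by case: fintype.split|by case: fintype.split|].
  rewrite big_split_ord; congr (_ + _); apply: eq_bigr => i _.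
    by rewrite (unsplitK (inl i)).
  by rewrite (unsplitK (inr i)).
- move=> a _ a0 [n [b [x [b0 Ax ->]]]].
  exists n, (fun i => a * b i), x; split=> // [i|]; first exact: mulr_ge0.
  by rewrite scaler_sumr; apply: eq_bigr => i _; rewrite scalerA.
Qed.

Lemma sub_conic_hull V (A : set V) : A `<=` conic_hull A.
Proof.
move=> v Av; exists 1, (fun=> 1), (fun=> v); split=> //.
by rewrite big_ord1 scale1r.
Qed.

Lemma conic_hull_min V (A B : set V) : A `<=` B -> convex_cone B ->
  conic_hull A `<=` B.
Proof.
move=> AB [B0 BD BZ] _ [n [a [x [a0 Ax ->]]]].
by elim/big_ind: _ => // i _; apply: BZ; [exact: a0|apply: AB; exact: Ax].
Qed.

Lemma convex_cone_preim V W (f : 'Hom(V, W)) (B : set W) :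
  convex_cone B -> convex_cone (f @^-1` B).
Proof.
case=> B0 BD BZ; split=> [|x y Bx By|a x a0 Bx] /=; rewrite ?linear0 //.
  by rewrite linearD; exact: BD.
by rewrite linearZ; exact: BZ.
Qed.
End Cones.

Definition stem (R : fieldType) (C : starAutCat) := starFunctor C (FVec R).

Definition sob R C (S : stem R C) (c : C) : vectType R := fob S c.
Coercion sob : stem >-> Funclass.

Section Stem.
Variables (R : fieldType) (C : starAutCat) (S : stem R C).

(* The structure maps of S, typed in the vector space library: smu and smuV are
   the identification S (a ⊗ b) = S a ⊗ S b, seps is R = S 1, and snu and snuV are
   S (a^* ) = (S a)'. *)
Definition smap (a b : C) (f : mor a b) : 'Hom(S a, S b) := fmor S f.
Definition smu (a b : C) : 'Hom(tensor (S a) (S b), S (a ⊗ b)) :=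
  fwd (fmu S a b).
Definition smuV (a b : C) : 'Hom(S (a ⊗ b), tensor (S a) (S b)) :=
  bwd (fmu S a b).
Definition seps : 'Hom(R^o, S unitc) := fwd (feps S).
Definition snu (a : C) : 'Hom(S a^*, dual (S a)) := fwd (fnu S a).
Definition snuV (a : C) : 'Hom(dual (S a), S a^*) := bwd (fnu S a).

(* S (1^* ) = (S 1)' = R' = R. *)
Definition sbot : 'Hom(S unitc^*, R^o) :=
  linfun (fun x : S unitc^* => ev (snu unitc x) (seps 1) : R^o).

(* S a ⊗ S b = S (a ⅋ b), through
   S a ⊗ S b = ((S a)' ⊗ (S b)')' = (S (a^* ) ⊗ S (b^* ))' = S (a^* ⊗ b^* )'. *)
Definition spar (a b : C) : 'Hom(tensor (S a) (S b), S (a ⅋ b)) :=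
  (snuV (a^* ⊗ b^*) \o vdual (smuV a^* b^*) \o vdual (tmap (snu a) (snu b))
     \o vpar (S a) (S b))%VF.

(* The maximally entangled state of S c, seen in S c ⊗ S (c^* ). *)
Definition smaxent (c : C) : tensor (S c) (S c^*) :=
  tmap \1%VF (snuV c) (maxent (S c)).

Lemma smap_id a : smap (idc a) = \1%VF.
Proof. exact: (fmor_id S a). Qed.
Lemma smap_comp (a b c : C) (g : mor b c) (f : mor a b) :
  smap (g \oc f) = (smap g \o smap f)%VF.
Proof. exact: (fmor_comp S g f). Qed.
Lemma smu_nat (a a' b b' : C) (f : mor a a') (g : mor b b') :
  (smu a' b' \o tmap (smap f) (smap g))%VF = (smap (f ⊗m g) \o smu a b)%VF.
Proof. exact: (fmu_nat S f g). Qed.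
Lemma smuK (a b : C) : (smuV a b \o smu a b)%VF = \1%VF.
Proof. exact: (fwdK (fmu S a b)). Qed.
Lemma smuVK (a b : C) : (smu a b \o smuV a b)%VF = \1%VF.
Proof. exact: (bwdK (fmu S a b)). Qed.
Lemma snuK (a : C) : (snuV a \o snu a)%VF = \1%VF.
Proof. exact: (fwdK (fnu S a)). Qed.
Lemma snuVK (a : C) : (snu a \o snuV a)%VF = \1%VF.
Proof. exact: (bwdK (fnu S a)). Qed.
Lemma snu_nat (a b : C) (f : mor a b) :
  (snu a \o smap f^*m)%VF = (vdual (smap f) \o snu b)%VF.
Proof. exact: (fnu_nat S f). Qed.
Lemma sbotE x : sbot x = ev (snu unitc x) (seps 1).
Proof. by rewrite linfun_linearE // => a y z; rewrite linearP evDl evZl. Qed.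

Lemma snuV_nat (a b : C) (f : mor a b) :
  (smap f^*m \o snuV b)%VF = (snuV a \o vdual (smap f))%VF.
Proof.
rewrite -[LHS]comp_lfun1l -(snuK a) -comp_lfunA (comp_lfunA (snu a)) snu_nat.
by rewrite -(comp_lfunA (vdual _)) snuVK comp_lfun1r.
Qed.

Lemma smuV_nat (a a' b b' : C) (f : mor a a') (g : mor b b') :
  (tmap (smap f) (smap g) \o smuV a b)%VF = (smuV a' b' \o smap (f ⊗m g))%VF.
Proof.
rewrite -[LHS]comp_lfun1l -(smuK a' b') -comp_lfunA (comp_lfunA (smu a' b')).
by rewrite smu_nat -(comp_lfunA (smap _)) smuVK comp_lfun1r.
Qed.

Lemma vdual_comp (U V W : vectType R) (g : 'Hom(V, W)) (f : 'Hom(U, V)) :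
  vdual (g \o f)%VF = (vdual f \o vdual g)%VF.
Proof.
by apply/lfunP => h; apply: dualP => v; rewrite comp_lfunE !vdualE comp_lfunE.
Qed.

Lemma vpar_nat (V V' W W' : vectType R) (f : 'Hom(V, V')) (g : 'Hom(W, W')) :
  (vpar V' W' \o tmap f g)%VF
  = (vdual (tmap (vdual f) (vdual g)) \o vpar V W)%VF.
Proof.
apply: tensorP => v w; rewrite !comp_lfunE tmapE; apply: tensorP => h k.
rewrite -[LHS]/(ev (vpar V' W' (tens (f v) (g w))) (tens h k)) vparE.
rewrite -[RHS]/(ev (vdual (tmap (vdual f) (vdual g)) (vpar V W (tens v w)))
                 (tens h k)).
by rewrite vdualE tmapE vparE !vdualE.
Qed.

Lemma tmap_comp (U V W U' V' W' : vectType R)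
    (g : 'Hom(V, W)) (f : 'Hom(U, V)) (g' : 'Hom(V', W')) (f' : 'Hom(U', V')) :
  tmap (g \o f) (g' \o f') = (tmap g g' \o tmap f f')%VF.
Proof. by apply: tensorP => v w; rewrite !(tmapE, comp_lfunE). Qed.

Lemma spar_nat (a a' b b' : C) (f : mor a a') (g : mor b b') :
  (spar a' b' \o tmap (smap f) (smap g))%VF
  = (smap (f^*m ⊗m g^*m)^*m \o spar a b)%VF.
Proof.
rewrite /spar -!comp_lfunA vpar_nat !comp_lfunA; congr (_ \o _)%VF.
rewrite snuV_nat -!comp_lfunA; congr (_ \o _)%VF.
rewrite -!vdual_comp; congr vdual.
rewrite -[RHS]comp_lfunA -smuV_nat !comp_lfunA; congr (_ \o _)%VF.
by rewrite -!tmap_comp !snu_nat.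
Qed.
End Stem.

Section Systems.
Variables (R : realType) (C : starAutCat) (S : stem R C).

Definition Acone (c : C) : set (S c) :=
  [set v | forall f : mor c unitc^*, 0 <= sbot S (smap S f v) :> R].

Arguments Acone c : clear implicits.

Definition Bcone (c : C) : set (S c) :=
  closurev (conic_hull [set v | exists f : mor unitc c,
                                  v = smap S f (seps S 1)]).

Arguments Bcone c : clear implicits.

Record ssystem (X : vectType R) := SSystem {
  cones :> forall c : C, set (tensor X (S c));
  cones_convex : forall c : C, convex_cone (@cones c);
  cones_closed : forall c : C, closedv (@cones c);
  cones_stable : forall (c d : C) (f : mor c d),
    tmap \1%VF (smap S f) @` @cones c `<=` @cones d }.
Arguments cones {X} _ _.

Definition CP (X Y : vectType R) (G : ssystem X) (E : ssystem Y) :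
    set 'Hom(X, Y) :=
  [set Psi | forall e : C, tmap Psi \1%VF @` G e `<=` E e].

Lemma convex_coneI (V : vectType R) I (F : I -> set V) :
  (forall i, convex_cone (F i)) -> convex_cone [set v | forall i, F i v].
Proof.
move=> cF; split=> [i|x y Fx Fy i|a x a0 Fx i]; case: (cF i) => F0 FD FZ.
- exact: F0.
- by apply: FD; [exact: Fx|exact: Fy].
- by apply: FZ => //; exact: Fx.
Qed.

Lemma Acone_convex c : convex_cone (Acone c).
Proof.
apply: convex_coneI => f; split=> [|x y x0 y0|a x a0 x0].
- by rewrite !linear0; exact: lexx.
- by rewrite !linearD; exact: addr_ge0.
- by rewrite !linearZ; exact: mulr_ge0.
Qed.

Lemma Acone_closed (c : C) : closedv (Acone c).
Proof.
have cl (f : mor c unitc^*) : closedv [set v | 0 <= sbot S (smap S f v) :> R]; last first.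
  exact: (closedv_bigcap cl).
have -> : [set v | 0 <= sbot S (smap S f v) :> R]
  = [set v | 0 <= (sbot S \o smap S f)%VF v :> R].
  by apply/seteqP; split=> v; rewrite /= comp_lfunE.
exact: closedv_ge0.
Qed.

Lemma Acone_stable (c d : C) (f : mor c d) :
  smap S f @` Acone c `<=` Acone d.
Proof.
by move=> _ [v Av <-] g /=; have := Av (g \oc f); rewrite smap_comp comp_lfunE.
Qed.

Lemma Bcone_convex c : convex_cone (Bcone c).
Proof. by apply: closurev_cone; exact: conic_hull_cone. Qed.

Lemma Bcone_closed c : closedv (Bcone c).
Proof. exact: closedv_closurev. Qed.

Lemma Bcone_stable (c d : C) (f : mor c d) :
  smap S f @` Bcone c `<=` Bcone d.
Proof.
suff H : Bcone c `<=` smap S f @^-1` Bcone d by move=> _ [v Bv <-]; exact: H.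
apply: closurev_min; last by apply: closedv_preim; exact: Bcone_closed.
apply: conic_hull_min; last by apply: convex_cone_preim; exact: Bcone_convex.
move=> _ [g ->]; apply: sub_closurev; apply: sub_conic_hull.
by exists (f \oc g); rewrite smap_comp comp_lfunE.
Qed.

Lemma intrinsic_stable (d e e' : C) (f : mor e e') :
  tmap \1%VF (smap S f) @` (smu S d e @^-1` Acone (d ⊗ e))
  `<=` smu S d e' @^-1` Acone (d ⊗ e').
Proof.
move=> _ [t At <-] /=.
rewrite -comp_lfunE -(smap_id S d) smu_nat comp_lfunE.
by apply: Acone_stable; exists (smu S d e t).
Qed.

Lemma cointrinsic_stable (d e e' : C) (f : mor e e') :
  tmap \1%VF (smap S f) @` (spar S d e @^-1` Bcone (d ⅋ e))
  `<=` spar S d e' @^-1` Bcone (d ⅋ e').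
Proof.
move=> _ [t Bt <-] /=.
rewrite -comp_lfunE -(smap_id S d) spar_nat comp_lfunE.
by apply: Bcone_stable; exists (spar S d e t).
Qed.

Definition intrinsic (d : C) : ssystem (S d) :=
  @SSystem (S d) (fun e => smu S d e @^-1` Acone (d ⊗ e))
    (fun e => @convex_cone_preim _ _ _ (smu S d e) _ (@Acone_convex (d ⊗ e)))
    (fun e => @closedv_preim _ _ _ (smu S d e) _ (@Acone_closed (d ⊗ e)))
    (@intrinsic_stable d).

Definition cointrinsic (d : C) : ssystem (S d) :=
  @SSystem (S d) (fun e => spar S d e @^-1` Bcone (d ⅋ e))
    (fun e => @convex_cone_preim _ _ _ (spar S d e) _ (@Bcone_convex (d ⅋ e)))
    (fun e => @closedv_preim _ _ _ (spar S d e) _ (@Bcone_closed (d ⅋ e)))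
    (@cointrinsic_stable d).

(* G(1^* ) as a cone in X, through X ⊗ S (1^* ) = X ⊗ R = X. *)
Definition system_bot (X : vectType R) (G : ssystem X) : set X :=
  (vrunit X \o tmap \1 (sbot S))%VF @` G unitc^*.

(* A(1^* ) as a cone in R. *)
Definition Abot : set R^o := sbot S @` Acone unitc^*.
End Systems.
Arguments cones {R C S X} _ _.
Arguments Acone {R C} S c.
Arguments Bcone {R C} S c.

(* Main.v *)
Require Import Defs.
From mathcomp Require Import all_boot all_order all_algebra.
From mathcomp Require Import all_classical reals topology normedtype.
Import GRing.Theory.
Local Open Scope classical_set_scope.
Local Open Scope ring_scope.
Local Open Scope cat_scope.

(** Both parts rest on one mechanism: by the adjunction, the morphisms that
    define the cones of c at an arbitrary e are obtained from one universal
    morphism for c and c^* by composition with morphisms between e and c^*.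
    The system G is stable under such morphisms.

    For maps out of the cointrinsic system, the generators of B(c ⅋ e) come
    from morphisms 1 -> (c^* ⊗ e^* )^*, and the adjunction matches these with
    morphisms p : 1 ⊗ c^* -> e, that is, with morphisms q : c^* -> e.  On the
    linear side this correspondence is the one between a linear map and its
    tensor: the generator of p is (id ⊗ S q)(m), with m the maximally entangled
    state of S c ([spar_maxent]).  Since G is stable under id ⊗ S q and closed
    under cone operations and limits, (Psi ⊗ id)(m) in G(c^* ) already forces
    Psi to be completely positive ([CP_cointrinsic]); taking q = id shows that
    m itself is in the cointrinsic cone ([maxent_cointrinsic]).

    For maps into the intrinsic system, a test morphism c ⊗ e -> 1^* factors as
    a fixed evaluation c ⊗ c^* -> 1^* after id ⊗ g with g : e -> c^*
    ([pairing_factor]), so testing at e reduces to testing at c^* after moving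
    the element of G(e) to G(c^* ) along g ([CP_intrinsic]).  The adjunction
    yields such a factorization through (c ⊗ 1^** )^* instead of c^*; the
    comparison of 1^** with 1 comes from the Yoneda lemma
    ([unitc_bidual_retract]).

    For c = 1 the test morphisms 1 ⊗ e -> 1^* are morphisms e -> 1^* up to the
    unit isomorphism, so only the cone G(1^* ) matters
    ([CP_intrinsic_unit]). *)

Lemma adj_surj {C : starAutCat} {a b c : C} (f : mor a (b ⊗ c^*)^*) :
  exists p : mor (a ⊗ b) c, adj p = f.
Proof. by case: (@adj_bij C a b c) => v _ vK; exists (v f); apply: vK. Qed.

Lemma adj_compl {C : starAutCat} {a a' b c : C} (f : mor a' a)
    (p : mor (a ⊗ b) c) :
  adj (p \oc (f ⊗m idc b)) = adj p \oc f.
Proof.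
have := adj_nat f (idc b) (idc c) p.
by rewrite !starm_id tmor_id starm_id !compc1l.
Qed.

(** Yoneda: C(a, 1) ~ C(a ⊗ 1, 1) ~ C(a, (1 ⊗ 1^* )^* ) naturally in a, so 1 is
    isomorphic to (1 ⊗ 1^* )^* and hence to 1^**.  The inverse law stated here
    makes (c ⊗ 1^** )^* a retract of c^*. *)
Lemma unitc_bidual_retract (C : starAutCat) :
  exists (i : mor (unitc : C) unitc^*^*) (r : mor unitc^*^* (unitc : C)),
    i \oc r = idc unitc^*^*.
Proof.
have [p adjp] := adj_surj (idc ((unitc : C) ⊗ unitc^*)^*).
have yoneda : adj (fwd (runit unitc)) \oc (p \oc bwd (runit _)) = idc _.
  by rewrite -adj_compl runit_nat -compcA fwdK compc1r.
exists ((bwd (lunit unitc^*))^*m \oc adj (fwd (runit unitc))).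
exists (p \oc bwd (runit _) \oc (fwd (lunit unitc^*))^*m).
rewrite compcA -(compcA (starm _) (adj _)) yoneda compc1r.
by rewrite -starm_comp bwdK starm_id.
Qed.

(** The evaluation pairing of c is universal among pairings of c with values in
    1^*: this is what reduces tests on c ⊗ e to tests on c ⊗ c^*. *)
Lemma pairing_factor {C : starAutCat} (c : C) :
  exists ev_c : mor (c ⊗ c^*) unitc^*,
    forall (e : C) (f : mor (c ⊗ e) unitc^*),
      exists g : mor e c^*, f = ev_c \oc (idc c ⊗m g).
Proof.
have [i [r ir]] := unitc_bidual_retract C.
(* p is the counit at 1^*: every q : e ⊗ c -> 1^* is p \oc (adj q ⊗m id). *)
have [p adjp] := adj_surj (idc (c ⊗ unitc^*^*)^*).
(* h and k embed (c ⊗ 1^** )^* into c^* as a retract, by dualizing c ~ c ⊗ 1^**. *)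
pose h := ((idc c ⊗m i) \oc bwd (runit c))^*m.
pose k := (fwd (runit c) \oc (idc c ⊗m r))^*m.
have kh : k \oc h = idc _.
  rewrite -starm_comp compcA -(compcA _ (bwd _)) fwdK compc1r.
  by rewrite -tmor_comp ir compc1l tmor_id starm_id.
exists (p \oc braid _ _ \oc (idc c ⊗m k)) => e f.
exists (h \oc adj (f \oc braid e c)).
rewrite -compcA -tmor_comp compc1l compcA kh compc1l.
rewrite -compcA braid_nat compcA.
have /(bij_inj (@adj_bij C _ _ _)) -> :
    adj (p \oc (adj (f \oc braid e c) ⊗m idc c)) = adj (f \oc braid e c).
  by rewrite adj_compl adjp compc1l.
by rewrite -compcA braidK compc1r.
Qed.

Lemma tmap_interchange {R : fieldType} {V W V' W' : vectType R} (f : 'Hom(V, V'))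
    (g : 'Hom(W, W')) t :
  tmap f \1%VF (tmap \1%VF g t) = tmap \1%VF g (tmap f \1%VF t).
Proof. by rewrite -!comp_lfunE -!tmap_comp !comp_lfun1l !comp_lfun1r. Qed.

Lemma tmap_id {R : fieldType} {V W : vectType R} : tmap \1 \1 = \1%VF :> 'Hom(tensor V W, _).
Proof. by apply: tensorP => v w; rewrite tmapE !id_lfunE. Qed.

(** The tensor of a linear map, read as a bilinear form on the duals, gives back
    the map: expand f in the dual basis. *)
Lemma ev_vpar_maxent {R : fieldType} {V W : vectType R} (g : 'Hom(dual V, W))
    (f : dual V) (k : dual W) :
  ev (vpar V W (tmap \1%VF g (maxent V))) (tens f k) = ev k (g f).
Proof.
rewrite /maxent !linear_sum ev_suml [in RHS](dualE f) linear_sum ev_sumr.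
by apply: eq_bigr => i _; rewrite /= tmapE id_lfunE vparE linearZ evZr.
Qed.

Section StemPairings.
Set Implicit Arguments.
Unset Strict Implicit.
Variables (R : fieldType) (C : starAutCat) (S : stem R C).

Lemma smuVKE (a b : C) t : smu S a b (smuV S a b t) = t.
Proof. by rewrite -comp_lfunE smuVK id_lfunE. Qed.
Lemma smuKE (a b : C) t : smuV S a b (smu S a b t) = t.
Proof. by rewrite -comp_lfunE smuK id_lfunE. Qed.
Lemma snuKE (a : C) x : snuV S a (snu S a x) = x.
Proof. by rewrite -comp_lfunE snuK id_lfunE. Qed.
Lemma snuVKE (a : C) f : snu S a (snuV S a f) = f.
Proof. by rewrite -comp_lfunE snuVK id_lfunE. Qed.

(** S((a ⊗ b)^* ) is the dual of S(a) ⊗ S(b), hence separated by pure tensors;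
    this lets equations in it be checked on bilinear forms. *)
Lemma star_tob_ext {a b : C} (u u' : S (a ⊗ b)^*) :
  (forall w z, ev (snu S _ u) (smu S a b (tens w z))
             = ev (snu S _ u') (smu S a b (tens w z))) ->
  u = u'.
Proof.
move=> e; rewrite -(snuKE u) -(snuKE u'); congr (snuV S _ _).
have E : vdual (smu S a b) (snu S _ u) = vdual (smu S a b) (snu S _ u').
  by apply: tensorP => w z; have := e w z; rewrite -!vdualE.
by apply: dualP => x; rewrite -(smuVKE x) -!vdualE E.
Qed.

Lemma ev_spar (a b : C) t (w : S a^*) (z : S b^*) :
  ev (snu S _ (spar S a b t)) (smu S _ _ (tens w z))
  = ev (vpar (S a) (S b) t) (tens (snu S a w) (snu S b z)).
Proof. by rewrite /spar !comp_lfunE snuVKE !vdualE smuKE tmapE. Qed.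

Lemma spar_inj (a b : C) : injective (spar S a b).
Proof.
move=> t t' e; apply: (bij_inj (vpar_bij (S a) (S b))).
apply: tensorP => f k; rewrite -(snuVKE f) -(snuVKE k).
by have := ev_spar t (snuV S a f) (snuV S b k); rewrite e ev_spar.
Qed.

(** The image under S of an adjunct, evaluated on pure tensors: the functor
    carries the adjunction of C to currying of linear maps. *)
Lemma ev_smap_adj {a b c : C} (p : mor (a ⊗ b) c) (v : S a) (w : S b)
    (z : S c^*) :
  ev (snu S _ (smap S (adj p) v)) (smu S _ _ (tens w z))
  = ev (snu S c z) (smap S p (smu S a b (tens v w))).
Proof.
have E : (vdual (smu S b c^* \o tmap \1 (snuV S c)) \o snu S (b ⊗ c^*)
           \o smap S (adj p))%VF = vadj (smap S p \o smu S a b)%VF.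
  exact: (fadj S p).
have := vadjE (smap S p \o smu S a b)%VF v w (snu S c z).
by rewrite -E !comp_lfunE vdualE comp_lfunE tmapE id_lfunE snuKE.
Qed.

Lemma smap_lunit (a : C) r (v : S a) :
  smap S (fwd (lunit a)) (smu S unitc a (tens (seps S r) v)) = r *: v.
Proof.
have E : (smap S (fwd (lunit a)) \o smu S unitc a \o tmap (seps S) \1)%VF
    = vlunit (S a) by exact: (fmu_lunit S a).
by rewrite -vlunitE -E !comp_lfunE tmapE id_lfunE.
Qed.

(** The Choi-Jamiolkowski correspondence inside the stem: the element of
    S(c ⅋ e) named by the adjunct of p is the tensor of the linear map
    S(c^* ) -> S(e) induced by p.  As bilinear forms, both send (w, z) to the
    value of z at the image of w. *)
Lemma spar_maxent {c e : C} (p : mor (unitc ⊗ c^*) e) :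
  spar S c e (tmap \1%VF (smap S (p \oc bwd (lunit c^*))) (smaxent S c))
  = smap S (adj p) (seps S 1).
Proof.
apply: star_tob_ext => w z; rewrite ev_smap_adj ev_spar /smaxent.
rewrite -[tmap \1 (smap _ _) _]comp_lfunE -tmap_comp comp_lfun1l.
rewrite ev_vpar_maxent comp_lfunE snuKE; congr ev.
rewrite -[in LHS](scale1r w) -smap_lunit -[LHS]comp_lfunE -smap_comp.
by rewrite -compcA fwdK compc1r.
Qed.

End StemPairings.

Section SystemMaps.
Set Implicit Arguments.
Unset Strict Implicit.
Variables (R : realType) (C : starAutCat) (S : stem R C).
Variables (X : vectType R) (G : ssystem S X).

(** The unit isomorphism 1 ⊗ c^* -> c^* names the maximally entangled state, so
    this state is one of the generators of B(c ⅋ c^* ). *)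
Lemma maxent_cointrinsic (c : C) : cointrinsic S c c^* (smaxent S c).
Proof.
have := spar_maxent S (fwd (lunit c^*)).
rewrite bwdK smap_id tmap_id id_lfunE /= => ->.
by apply: sub_closurev; apply: sub_conic_hull; eexists.
Qed.

(** The condition on an element of S(c ⅋ e) that its preimage be mapped into
    G(e) defines a closed convex cone, so it need only be checked on the
    generators of B(c ⅋ e), which [spar_maxent] identifies with transports of
    the maximally entangled state. *)
Lemma CP_cointrinsic (c : C) (Psi : 'Hom(S c, X)) :
  G c^* (tmap Psi \1%VF (smaxent S c)) -> CP (cointrinsic S c) G Psi.
Proof.
move=> Gm e _ [t Bt <-].
have sparK : cancel (spar S c e) (spar S c e)^-1%VF.
  by apply: lker0_lfunK; apply/lker0P; exact: spar_inj.
pose F := (tmap Psi \1 \o (spar S c e)^-1)%VF.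
suff BF : Bcone S (c ⅋ e) `<=` F @^-1` G e.
  by have := BF _ Bt; rewrite /= comp_lfunE sparK.
apply: closurev_min; last by apply: closedv_preim; exact: cones_closed.
apply: conic_hull_min; last by apply: convex_cone_preim; exact: cones_convex.
move=> _ [f ->].
have [p <-] := adj_surj f.
rewrite -spar_maxent /F /= comp_lfunE sparK tmap_interchange.
by apply: cones_stable; eexists; first exact: Gm.
Qed.

(** By [pairing_factor], moving an element of G(e) into G(c^* ) along g trades a
    test at e for the evaluation test at c^*. *)
Lemma CP_intrinsic (c : C) (Psi : 'Hom(X, S c)) :
  (smu S c c^* \o tmap Psi \1)%VF @` G c^* `<=` Acone S (c ⊗ c^*) ->
  CP G (intrinsic S c) Psi.
Proof.
move=> GA e _ [t Gt <-] f; have [ev_c fac] := pairing_factor c.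
have [g ->] := fac _ f.
have Gg : G c^* (tmap \1%VF (smap S g) t) by apply: cones_stable; exists t.
have /GA /(_ ev_c) : ((smu S c c^* \o tmap Psi \1)%VF @` G c^*)
   ((smu S c c^* \o tmap Psi \1)%VF (tmap \1%VF (smap S g) t)).
  by exists (tmap \1%VF (smap S g) t).
rewrite comp_lfunE tmap_interchange smap_comp.
by rewrite -(smap_id S c) -[smu S c c^* _]comp_lfunE smu_nat !comp_lfunE.
Qed.

(** On the unit object the identification of 1 ⊗ e with e turns a test into a
    morphism g : e -> 1^*, and S(g) commutes with psi; what remains is the value
    of psi at a point of G(1^* ), tested by the identity of 1^*. *)
Lemma CP_intrinsic_unit (psi : 'Hom(X, R^o)) :
  Pos (system_bot G) (Abot S) psi -> CP G (intrinsic S unitc) (seps S \o psi)%VF.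
Proof.
move=> Ppsi e _ [t Gt <-] f.
pose g := f \oc bwd (lunit e).
have -> : f = g \oc fwd (lunit e) by rewrite -compcA fwdK compc1r.
have Gg : G unitc^* (tmap \1%VF (smap S g) t) by apply: cones_stable; exists t.
(* On x ⊗ v both sides are the product of psi x and sbot (S(g) v). *)
have E : (sbot S \o smap S (g \oc fwd (lunit e)) \o smu S unitc e
           \o tmap (seps S \o psi) \1)%VF
  = (psi \o (vrunit X \o tmap \1 (sbot S)) \o tmap \1 (smap S g))%VF.
  apply: tensorP => x v; rewrite smap_comp !comp_lfunE !tmapE comp_lfunE !id_lfunE.
  rewrite smap_lunit vrunitE !linearZ; exact: mulrC.
have [a Aa] : Abot S (psi ((vrunit X \o tmap \1 (sbot S))%VF
                             (tmap \1%VF (smap S g) t))).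
  by apply: Ppsi; eexists; last reflexivity; exists (tmap \1%VF (smap S g) t).
have := Aa (idc _); rewrite smap_id id_lfunE => a0 aE.
move: a0; rewrite aE -!comp_lfunE.
rewrite comp_lfunA -E.
by rewrite !comp_lfunE.
Qed.
End SystemMaps.

Theorem theorem3p26 (R : realType) (C : starAutCat) (S : stem R C)
    (X : vectType R) (G : ssystem S X) (c : C) :
  [/\ forall Psi : 'Hom(S c, X),
        [<-> CP (cointrinsic S c) G Psi;
             tmap Psi \1%VF @` cointrinsic S c c^* `<=` G c^*;
             G c^* (tmap Psi \1%VF (smaxent S c))],
      forall Psi : 'Hom(X, S c),
        CP G (intrinsic S c) Psi <->
        (smu S c c^* \o tmap Psi \1)%VF @` G c^* `<=` Acone S (c ⊗ c^*)
    & forall psi : 'Hom(X, R^o),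
        Pos (system_bot G) (Abot S) psi ->
        CP G (intrinsic S unitc) (seps S \o psi)%VF].
Proof.
split=> [Psi|Psi|psi].
- tfae=> [cp|B_G|]; [exact: cp| |exact: CP_cointrinsic].
  by apply: B_G; exists (smaxent S c) => //; exact: maxent_cointrinsic.
- split=> [cp _ [t Gt <-]|]; last exact: CP_intrinsic.
  by rewrite comp_lfunE; apply: (cp c^*); exists t.
- exact: CP_intrinsic_unit.
Qed.
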